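(* Let $f\colon I\to\mathbb{R}$ be a continuous function defined on an interval $I\subseteq\mathbb{R}$, and let $m$ and $n$ be natural numbers ($m,n\ge 1$). If $f$ is convex, then the inequality $$\operatorname{Tr}\left(f\left(\sum_{i=1}^n a_i^*x_ia_i\right)\right)\le\operatorname{Tr}\left(\sum_{i=1}^n a_i^*f(x_i)a_i\right)\qquad( * )$$ holds for every $n$-tuple $(x_1,\dots,x_n)$ of self-adjoint complex $m\times m$ matrices with spectra contained in $I$ and every $n$-tuple $(a_1,\dots,a_n)$ of complex $m\times m$ matrices with $\sum_{k=1}^n a_k^*a_k=\mathbf{1}$. Conversely, if for some $n$ and $m$ with $n>1$ the inequality $( * )$ is satisfied for all such tuples $(x_1,\dots,x_n)$ and $(a_1,\dots,a_n)$, then $f$ is convex.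
   Context: $\operatorname{Tr}$ is the usual matrix trace, $\mathbf{1}$ the identity matrix. For a self-adjoint matrix $x$ with spectrum in $I$, $f(x)$ is defined by the spectral functional calculus. ''Convex'' means convex as a real function on $I$. *)

(* Defs.v *)
From HB Require Import structures.
From mathcomp Require Import all_boot all_order all_algebra.
From mathcomp Require Import all_classical all_reals all_analysis.
From mathcomp Require Import complex.
From mathcomp Require Import spectral sesquilinear.

Set Implicit Arguments.
Unset Strict Implicit.
Unset Printing Implicit Defensive.

Import Order.TTheory GRing.Theory Num.Theory Num.Def.
Import numFieldNormedType.Exports.

Local Open Scope classical_set_scope.
Local Open Scope ring_scope.
Local Open Scope sesquilinear_scope.

Definition spectrum (R : realType) (m : nat) (x : 'M[R[i]]_m) : set R[i] :=
  [set z | eigenvalue x z].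

Definition real_image (R : realType) (I : interval R) : set R[i] :=
  (fun r : R => r%:C%C) @` [set` I].

(* Spectral functional calculus.  [spectralmx x] is a unitary [U] and
   [spectral_diag x] a row [d] with [x = U^-1 *m diag_mx d *m U], for [x] normal
   (in particular self-adjoint, and then [d] is real).  The value does not
   depend on the diagonalization chosen by the library: see [funcalcE].
   Entries of [d] lie in the spectrum, so when it is contained in [I] only the
   values of [f] on [I] matter. *)
Definition funcalc (R : realType) (m : nat) (f : R -> R) (x : 'M[R[i]]_m) :
    'M[R[i]]_m :=
  invmx (spectralmx x)
    *m diag_mx (map_mx (fun z : R[i] => (f (complex.Re z))%:C%C)
                       (spectral_diag x))
    *m spectralmx x.

Lemma funcalcE (R : realType) (m : nat) (f : R -> R) (U : 'M[R[i]]_m)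
    (d : 'rV[R[i]]_m) : U \is unitarymx ->
  funcalc f (U^t* *m diag_mx d *m U) =
  U^t* *m diag_mx (map_mx (fun z : R[i] => (f (complex.Re z))%:C%C) d) *m U.
Proof.
move=> Uu; set x := (X in funcalc f X).
have xN : x \is normalmx.
  apply/orthomx_spectral_subproof; exists (U, d) => //=.
  by rewrite invmx_unitary.
have /orthomx_spectralP xE := xN.
have Pu := spectral_unitarymx x; have Pun := spectral_unit x.
rewrite /funcalc; set P := spectralmx x in xE Pu Pun *.
set e := spectral_diag x in xE *; set g := (X in map_mx X).
have WE : (U *m invmx P) *m diag_mx e = diag_mx d *m (U *m invmx P).
  have := xE; rewrite {1}/x => /(congr1 (fun M => U *m M *m invmx P)).
  rewrite !mulmxA (unitarymxP Uu) mul1mx (mulmxK Pun) => /esym H.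
  by rewrite H.
have WgE : (U *m invmx P) *m diag_mx (map_mx g e) =
           diag_mx (map_mx g d) *m (U *m invmx P).
  apply/matrixP => i j; have /matrixP/(_ i j) := WE.
  rewrite !mul_mx_diag !mul_diag_mx !mxE.
  set w := \sum_(_ < _) _; have [->|w0] := eqVneq w 0.
    by rewrite !(mul0r, mulr0).
  by rewrite mulrC => /(mulIf w0) ->; rewrite mulrC.
have UtU : U^t* *m U = 1%:M by rewrite -invmx_unitary // mulVmx // unitarymx_unit.
have := congr1 (fun M => U^t* *m M *m P) WgE.
by rewrite !mulmxA UtU mul1mx -!mulmxA mulVmx// mulmx1.
Qed.

(* Both traces are real, so comparing them in [R[i]] (where [z <= w] means
   equal imaginary parts and [Re z <= Re w]) is the comparison in [R]. *)
Definition trace_jensen (R : realType) (I : interval R) (f : R -> R)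
    (m n : nat) : Prop :=
  forall x a : 'I_n -> 'M[R[i]]_m,
    (forall i, x i \is hermsymmx) ->
    (forall i, spectrum (x i) `<=` real_image I) ->
    \sum_k (a k)^t* *m a k = 1%:M ->
  \tr (funcalc f (\sum_i (a i)^t* *m x i *m a i))
    <= \tr (\sum_i (a i)^t* *m funcalc f (x i) *m a i).

(* Main.v *)
Require Import Defs.
From HB Require Import structures.
From mathcomp Require Import all_boot all_order all_algebra.
From mathcomp Require Import all_classical all_reals all_analysis.
From mathcomp Require Import complex spectral sesquilinear ring lra.

Set Implicit Arguments.
Unset Strict Implicit.
Unset Printing Implicit Defensive.

Import Order.TTheory GRing.Theory Num.Theory.
Import numFieldNormedType.Exports.
Local Open Scope classical_set_scope.
Local Open Scope ring_scope.
Local Open Scope sesquilinear_scope.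

(** The trace inequality is the scalar Jensen inequality, applied to each
    diagonal entry in a basis diagonalizing y = \sum_i a_i^* x_i a_i.

    Write x_i = U_i^* D_i U_i and y = V^* E V with U_i, V unitary and D_i, E
    real diagonal, and put B_i = U_i a_i V^*.  Conjugating by V turns
    \sum_i a_i^* g(x_i) a_i into \sum_i B_i^* g(D_i) B_i, whose j-th diagonal
    entry is \sum_(i, k) w_j(i, k) g(D_i k k) with the nonnegative weights
    w_j(i, k) = |B_i k j|^2 ([sandwich_diagE]).  Three choices of g matter:
    - g = 1: the matrix is V V^* = 1, so the weights w_j sum to 1;
    - g = id: the matrix is V y V^* = E, so the eigenvalue E j j is the
      w_j-average of the eigenvalues D_i k k, all of which lie in I;
    - g = f: the diagonal entries add up to the right-hand trace.
    Jensen's inequality ([jensen_sum]) bounds f (E j j) by the j-th diagonal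
    entry for g = f, and the sum over j is the trace inequality.

    Conversely, scalar matrices reduce the trace inequality to the definition
    of convexity: x_0 = u, x_1 = v, a_0 = sqrt t, a_1 = sqrt (1 - t), and all
    other a_k = 0 give m f(t u + (1 - t) v) <= m (t f u + (1 - t) f v). *)

(** * The finite Jensen inequality *)

Lemma convex_function_conv (R : realType) (I : interval R) (f : R -> R) :
  @convex_function R R^o [set` I] f <->
  forall t x y : R, 0 <= t <= 1 -> x \in I -> y \in I ->
    f (t * x + (1 - t) * y) <= t * f x + (1 - t) * f y.
Proof.
split=> [cf t x y /andP[t0 t1] xI yI|cf t x y].
  by have := cf (Itv01 t0 t1) x y; rewrite !inE /=; apply.
by rewrite !inE => xI yI; apply: cf => //; rewrite ge0 le1.
Qed.

Lemma interval_conv (R : realType) (I : interval R) (t x y : R) :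
  0 <= t <= 1 -> x \in I -> y \in I -> t * x + (1 - t) * y \in I.
Proof.
move=> /andP[t0 t1]; wlog xy : t x y t0 t1 / x <= y => [H xI yI|xI yI].
  case: (leP x y) => [xy|/ltW yx]; first exact: H.
  have := H (1 - t) y x; rewrite subKr [t * x + _]addrC; apply=> //; lra.
by apply: (@interval_is_interval R I x y) => //; apply/andP; split; nra.
Qed.

(** The base point [u] of weight [c > 0] makes the induction work: each further
    point is absorbed into it, replacing [u] by a barycentre of [u] and the new
    point and increasing [c].  The total weight thus never vanishes, and no case
    distinction on zero weights arises. *)
Lemma jensen_seq {R : realType} {I : interval R} {f : R -> R}
    {T : Type} {w z : T -> R} :
  @convex_function R R^o [set` I] f ->
  (forall k, 0 <= w k) -> (forall k, z k \in I) ->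
  forall (s : seq T) (c u : R), 0 < c -> u \in I ->
  let W := c + \sum_(k <- s) w k in
  W * f ((c * u + \sum_(k <- s) w k * z k) / W)
    <= c * f u + \sum_(k <- s) w k * f (z k).
Proof.
move=> /convex_function_conv cf w0 zI; elim=> [|a s IHs] c u c0 uI /=.
  by rewrite !big_nil !addr0 mulrAC mulfV ?mul1r ?gt_eqF.
have wa := w0 a; have d0 : 0 < c + w a by lra.
pose t := c / (c + w a); have t01 : 0 <= t <= 1.
  by apply/andP; split; [apply: divr_ge0; lra | rewrite ler_pdivrMr// mul1r; lra].
have dt : (c + w a) * t = c by rewrite mulrC divfK// gt_eqF.
(* [t] is the proportion of the base point in the merged one. *)
have dE q r : (c + w a) * (t * q + (1 - t) * r) = c * q + w a * r.
  transitivity ((c + w a) * t * q + (c + w a - (c + w a) * t) * r); first by ring.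
  by rewrite dt; ring.
have ct := cf t u (z a) t01 uI (zI a).
have := IHs (c + w a) (t * u + (1 - t) * z a) d0 (interval_conv t01 uI (zI a)).
rewrite /= !big_cons !addrA dE => /le_trans; apply; rewrite lerD2r -dE.
by rewrite ler_pM2l.
Qed.

Lemma jensen_sum {R : realType} {I : interval R} {f : R -> R}
    {T : finType} {w z : T -> R} :
  @convex_function R R^o [set` I] f ->
  (forall k, 0 <= w k) -> \sum_k w k = 1 -> (forall k, z k \in I) ->
  f (\sum_k w k * z k) <= \sum_k w k * f (z k).
Proof.
move=> cf w0 w1 zI.
(* A point of positive weight serves as the base point of [jensen_seq]. *)
have [k wk] : exists k, 0 < w k.
  apply/existsP; apply: contraT => /existsPn w_le0.
  have : \sum_k w k <= 0 by apply: sumr_le0 => k _; rewrite leNgt w_le0.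
  by rewrite w1 ler10.
have split_k (g : T -> R) :
    g k + \sum_(j <- [seq j <- index_enum T | j != k]) g j = \sum_j g j.
  by rewrite big_filter [RHS](bigD1 k).
have := jensen_seq cf w0 zI [seq j <- index_enum T | j != k] wk (zI k).
by rewrite /= !split_k w1 mul1r divr1.
Qed.

(** * Self-adjoint matrices in their eigenbases *)

Section Spectral.
Variables (R : realType) (m : nat).
Implicit Type x : 'M[R[i]]_m.

Definition sqnorm (z : R[i]) : R := complex.Re z ^+ 2 + complex.Im z ^+ 2.

Lemma sqnorm_ge0 z : 0 <= sqnorm z.
Proof. by rewrite addr_ge0 ?sqr_ge0. Qed.

Lemma sqnormE z : (sqnorm z)%:C%C = Num.conj z * z.
Proof. by rewrite add_Re2_Im2 normCK mulrC. Qed.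

Lemma adjmxM (n p q : nat) (A : 'M[R[i]]_(n, p)) (B : 'M[R[i]]_(p, q)) :
  (A *m B)^t* = B^t* *m A^t*.
Proof. by rewrite trmx_mul map_mxM. Qed.

(** Source of the Jensen weights: on the diagonal, conjugating a real diagonal
    matrix by [B] mixes its entries with the squared moduli of a column. *)
Lemma sandwich_diagE (n : nat) (B : 'M[R[i]]_(n, m)) (g : 'I_n -> R) j :
  (B^t* *m diag_mx (\row_k (g k)%:C%C) *m B) j j =
  (\sum_k sqnorm (B k j) * g k)%:C%C.
Proof.
rewrite mul_mx_diag mxE rmorph_sum; apply: eq_bigr => k _.
by rewrite !mxE rmorphM /= sqnormE mulrAC.
Qed.

Lemma unitary_adjK (V : 'M[R[i]]_m) : V \is unitarymx -> V^t* *m V = 1%:M.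
Proof.
by move=> Vu; rewrite -(invmx_unitary Vu) mulVmx// (unitarymx_unit Vu).
Qed.

(** The eigenvalues are written here as embedded real numbers, so that [x] has
    the shape of [funcalc id x] and can be handled together with [funcalc f x]. *)
Lemma hermsymmx_spectral x : x \is hermsymmx ->
  x = (spectralmx x)^t* *m
        diag_mx (\row_k (complex.Re (spectral_diag x 0 k))%:C%C) *m spectralmx x.
Proof.
move=> xH; have /hermitian_normalmx/orthomx_spectralP := xH.
rewrite (invmx_unitary (spectral_unitarymx x)).
have /mxOverP dR := hermitian_spectral_diag_real xH.
suff <- : spectral_diag x = \row_k (complex.Re (spectral_diag x 0 k))%:C%C by [].
by apply/rowP => k; rewrite mxE RRe_real.
Qed.

Lemma funcalc_spectral (f : R -> R) x :
  funcalc f x = (spectralmx x)^t* *m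
    diag_mx (\row_k (f (complex.Re (spectral_diag x 0 k)))%:C%C) *m spectralmx x.
Proof.
rewrite /funcalc (invmx_unitary (spectral_unitarymx x)).
suff -> : map_mx (fun z : R[i] => (f (complex.Re z))%:C%C) (spectral_diag x) =
    \row_k (f (complex.Re (spectral_diag x 0 k)))%:C%C by [].
by apply/rowP => k; rewrite !mxE.
Qed.

(** A diagonal entry is an eigenvalue: the [k]-th row of the unitary
    [spectralmx x] is an eigenvector, nonzero as a row of an invertible
    matrix. *)
Lemma spectral_diag_mem (I : interval R) x k : x \is hermsymmx ->
  spectrum x `<=` real_image I -> complex.Re (spectral_diag x 0 k) \in I.
Proof.
move=> xH xI; have /hermitian_normalmx/orthomx_spectralP xE := xH.
have Uu := spectral_unit x.
suff /xI[r rI <-] : spectrum x (spectral_diag x 0 k) by exact: rI.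
apply/eigenvalueP; exists (row k (spectralmx x)).
  rewrite {2}xE mulmxA mulmxA -row_mul mulmxV// row1 -rowE.
  by rewrite row_diag_mx -scalemxAl -rowE.
apply: contraTneq Uu => r0; rewrite unitmxE (expand_det_row _ k).
rewrite big1 ?unitr0// => j _.
by have /rowP/(_ j) := r0; rewrite !mxE => ->; rewrite mul0r.
Qed.

Lemma unitary_trace (V A : 'M[R[i]]_m) : V \is unitarymx ->
  \tr A = \tr (V *m A *m V^t*).
Proof.
by move=> Vu; rewrite mxtrace_mulC mulmxA (unitary_adjK Vu) mul1mx.
Qed.

Lemma unitary_sandwichK (V A : 'M[R[i]]_m) : V \is unitarymx ->
  V *m (V^t* *m A *m V) *m V^t* = A.
Proof.
move=> Vu; have VV : V *m V^t* = 1%:M by apply/unitarymxP.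
by rewrite !mulmxA VV mul1mx -mulmxA VV mulmx1.
Qed.

End Spectral.

(** * Convexity and the trace inequality *)

Lemma trace_jensen_convex (R : realType) (I : interval R) (f : R -> R)
  (m n : nat) : @convex_function R R^o [set` I] f -> trace_jensen I f m n.
Proof.
move=> cf x a xH xI a1; set y := \sum_i (a i)^t* *m x i *m a i.
have yH : y \is hermsymmx.
  apply/is_hermitianmxP; rewrite expr0 scale1r /y !raddf_sum /=.
  apply: eq_bigr => i _; have := is_hermitianmxP _ _ _ (xH i).
  by rewrite expr0 scale1r !adjmxM trmxCK => <-; rewrite mulmxA.
pose V := spectralmx y; have Vu : V \is unitarymx := spectral_unitarymx y.
have VV : V *m V^t* = 1%:M by apply/unitarymxP.
pose B i := spectralmx (x i) *m a i *m V^t*.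
pose w j (p : 'I_n * 'I_m) := sqnorm (B p.1 p.2 j).
pose z (p : 'I_n * 'I_m) := complex.Re (spectral_diag (x p.1) 0 p.2).
(* [G] stands for [funcalc g \o x]; it is a parameter because [1%:M] and [x]
   have this form only up to a provable equality. *)
have sandE (g : R -> R) (G : 'I_n -> 'M[R[i]]_m) j :
    (forall i, G i = (spectralmx (x i))^t* *m
       diag_mx (\row_k (g (z (i, k)))%:C%C) *m spectralmx (x i)) ->
    (V *m (\sum_i (a i)^t* *m G i *m a i) *m V^t*) j j
    = (\sum_p w j p * g (z p))%:C%C.
  move=> GE; rewrite mulmx_sumr mulmx_suml summxE.
  transitivity (\sum_i (\sum_k w j (i, k) * g (z (i, k)))%:C%C).
    apply: eq_bigr => i _; rewrite -(@sandwich_diagE _ _ _ (B i) (fun k => g (z (i, k)))).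
    by rewrite GE /B !adjmxM trmxCK !mulmxA.
  by rewrite -rmorph_sum pair_bigA /=; congr (_%:C%C); apply: eq_bigr => -[].
have w1 j : \sum_p w j p = 1.
  have := sandE (fun=> 1) (fun=> 1%:M) j; under eq_bigr do rewrite mulmx1.
  rewrite a1 mulmx1 VV mxE eqxx mulr1n => w1; apply/esym/complexI.
  under eq_bigr do rewrite -[w _ _]mulr1.
  apply: w1 => i; rewrite (_ : diag_mx _ = 1%:M).
    by rewrite mulmx1 (unitary_adjK (spectral_unitarymx (x i))).
  by rewrite -diag_const_mx; congr diag_mx; apply/rowP => k; rewrite !mxE.
have yE j : complex.Re (spectral_diag y 0 j) = \sum_p w j p * z p.
  apply: complexI.
  rewrite -(sandE id x j (fun i => hermsymmx_spectral (xH i))) -/y.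
  rewrite [in RHS](hermsymmx_spectral yH) (unitary_sandwichK _ Vu).
  by rewrite !mxE eqxx mulr1n.
rewrite (unitary_trace _ Vu) [leRHS](unitary_trace _ Vu).
rewrite /mxtrace; apply: ler_sum => j _.
rewrite (sandE f _ j (fun i => funcalc_spectral f (x i))).
rewrite funcalc_spectral (unitary_sandwichK _ Vu) !mxE eqxx mulr1n lecR yE.
apply: jensen_sum => // [p|p]; first exact: sqnorm_ge0.
exact: spectral_diag_mem.
Qed.

Lemma hermsymmx_scalar (R : realType) (m : nat) (u : R) :
  (u%:C%C%:M : 'M[R[i]]_m) \is hermsymmx.
Proof.
apply/is_hermitianmxP; rewrite expr0 scale1r tr_scalar_mx map_scalar_mx /=.
by congr (_%:M); apply/esym/CrealP; apply/complex_realP; exists u.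
Qed.

Lemma funcalc_scalar (R : realType) (m : nat) (f : R -> R) (u : R) :
  funcalc f (u%:C%C%:M : 'M[R[i]]_m) = (f u)%:C%C%:M.
Proof.
have U1 : (1%:M : 'M[R[i]]_m) \is unitarymx.
  by apply/unitarymxP; rewrite trmx1 map_mx1 mulmx1.
have := funcalcE f (const_mx u%:C%C) U1.
by rewrite map_const_mx !diag_const_mx trmx1 map_mx1 !mul1mx !mulmx1.
Qed.

Lemma spectrum_scalar (R : realType) (I : interval R) (m : nat) (u : R) :
  u \in I -> spectrum (u%:C%C%:M : 'M[R[i]]_m) `<=` real_image I.
Proof.
move=> uI z /eigenvalueP[v]; rewrite mul_mx_scalar => /eqP.
rewrite -subr_eq0 -scalerBl scaler_eq0 => /orP[|/eqP->]; last by rewrite eqxx.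
by rewrite subr_eq0 => /eqP <- _; exists u.
Qed.

(** Scalar matrices suffice: on them the two traces are [m] times the two sides
    of the convexity inequality, and [0 < m] can be cancelled. *)
Lemma convex_trace_jensen (R : realType) (I : interval R) (f : R -> R)
  (m n : nat) : (1 <= m)%N -> (1 < n)%N -> trace_jensen I f m n ->
  @convex_function R R^o [set` I] f.
Proof.
case: m n => // m [|[|n]]// _ _ tj; apply/convex_function_conv => t u v t01 uI vI.
have /andP[t0 t1] := t01; have s0 : 0 <= 1 - t by lra.
pose p (k : 'I_n.+2) : R := if k == 0 then u else v.
pose c (k : 'I_n.+2) : R :=
  if k == 0 then Num.sqrt t else if k == 1 then Num.sqrt (1 - t) else 0.
have cE (g : 'I_n.+2 -> R) :
    \sum_k c k ^+ 2 * g k = t * g 0 + (1 - t) * g 1.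
  rewrite big_ord_recl big_ord_recl big1 ?addr0 => [|k _].
    by rewrite /c /= !sqr_sqrtr// (_ : lift ord0 ord0 = 1)//; apply: val_inj.
  by rewrite (_ : c _ = 0) ?expr0n ?mul0r.
have sand (q r : R) : ((q%:C%C%:M)^t* *m r%:C%C%:M *m q%:C%C%:M : 'M[R[i]]_m.+1)
   = ((q ^+ 2 * r)%:C)%C%:M.
  have := is_hermitianmxP _ _ _ (hermsymmx_scalar m.+1 q).
  rewrite expr0 scale1r => <-.
  by rewrite -!scalar_mxM; congr (_%:M); rewrite -!rmorphM; congr (_%:C%C); ring.
have sum (g : 'I_n.+2 -> R) :
    \sum_k ((c k)%:C%C%:M)^t* *m (g k)%:C%C%:M *m (c k)%:C%C%:M =
    ((t * g 0 + (1 - t) * g 1)%:C%C)%:M :> 'M[R[i]]_m.+1.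
  rewrite -cE; under eq_bigr do rewrite sand.
  by rewrite -raddf_sum -rmorph_sum.
have := tj (fun k => (p k)%:C%C%:M) (fun k => (c k)%:C%C%:M) _ _ _.
under [X in _ <= \tr X]eq_bigr do rewrite funcalc_scalar.
rewrite sum (sum (f \o p)) funcalc_scalar !mxtrace_scalar.
rewrite -!rmorphMn lecR lerMn2r /=; apply=> [k|k|].
- exact: hermsymmx_scalar.
- by apply: spectrum_scalar; rewrite /p; case: ifP.
- under eq_bigr do rewrite -[_^t*]mulmx1.
  by rewrite (sum (fun=> 1)) !mulr1 addrC subrK.
Qed.

Theorem theorem2p4 (R : realType) (I : interval R) (f : R -> R)
  (fcont : {within [set` I], continuous f}) :
  (@convex_function R R^o [set` I] f ->
     forall m n : nat, (1 <= m)%N -> (1 <= n)%N -> trace_jensen I f m n)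
  /\
  ((exists m n : nat, [/\ (1 <= m)%N, (1 < n)%N & trace_jensen I f m n]) ->
     @convex_function R R^o [set` I] f).
Proof.
split=> [cf m n _ _|[m [n [m1 n1 tj]]]]; first exact: trace_jensen_convex.
exact: (convex_trace_jensen m1 n1 tj).
Qed.
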